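(* Over $\mathfrak{S}_n$, the following triples of set-valued statistics all have the same joint distribution (i.e., for each triple $(T_1,T_2,T_3)$ in the list and every triple of sets $(X,Y,Z)$, the number of $\sigma\in\mathfrak{S}_n$ with $(T_1(\sigma),T_2(\sigma),T_3(\sigma))=(X,Y,Z)$ is independent of the chosen triple): (1) $(\mathsf{Rmil},\mathsf{Lmil},\mathsf{Lmap})$; (2) $(\mathsf{Cyc},\mathsf{Lmic}_1,\mathsf{Lmap})$; (3) $(\mathsf{Lmap},\mathsf{Lmip},\mathsf{Rmil})$; (4) $(\mathsf{Rmip}^*,\mathsf{Rmap}^*,\mathsf{Lmal}^* )$; (5) $(\mathsf{Lmal}^*,\mathsf{Rmal}^*,\mathsf{Rmip}^* )$; (6) $(\mathsf{Lmil},\mathsf{Rmil},\mathsf{Rmap}^* )$; (7) $(\mathsf{Rmal}^*,\mathsf{Lmal}^*,\mathsf{Lmip})$; (8) $(\mathsf{Rmap}^*,\mathsf{Rmip}^*,\mathsf{Lmil})$; (9) $(\mathsf{Lmip},\mathsf{Lmap},\mathsf{Rmal}^* )$. Moreover, the following partial triples (a dash means the entry is omitted) have the same joint distribution as the entries in the same positions of triple (1): (10) $(\mathsf{Lmap},-,\mathsf{Cyc})$; (11) $(\mathsf{Lmic}_1,\mathsf{Cyc},-)$; (12) $(\mathsf{Cyc},-,\mathsf{Rmil})$; (13) $(\mathsf{Rmil},-,\mathsf{Cyc})$.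
   Context: $\mathfrak{S}_n$ is the symmetric group on $[n]$, permutations in one-line notation $\sigma=\sigma_1\cdots\sigma_n$. Set-valued statistics: $\mathsf{Lmil}(\sigma)=\{\sigma_i:\sigma_i<\sigma_j\ \forall j<i\}$, $\mathsf{Lmip}(\sigma)=\{i:\sigma_i<\sigma_j\ \forall j<i\}$, $\mathsf{Rmil}(\sigma)=\{\sigma_i:\sigma_i<\sigma_j\ \forall j>i\}$, $\mathsf{Rmip}(\sigma)=\{i:\sigma_i<\sigma_j\ \forall j>i\}$, $\mathsf{Lmal}(\sigma)=\{\sigma_i:\sigma_i>\sigma_j\ \forall j<i\}$, $\mathsf{Lmap}(\sigma)=\{i:\sigma_i>\sigma_j\ \forall j<i\}$, $\mathsf{Rmal}(\sigma)=\{\sigma_i:\sigma_i>\sigma_j\ \forall j>i\}$, $\mathsf{Rmap}(\sigma)=\{i:\sigma_i>\sigma_j\ \forall j>i\}$. $\mathsf{Cyc}(\sigma)$ is the set of smallest elements of the cycles of $\sigma$. For a set-valued statistic $\mathsf{Stat}$ with values in subsets of $[n]$, $\mathsf{Stat}^*(\sigma)=\{n+1-i:i\in\mathsf{Stat}(\sigma)\}$. The $B$-code is $B(\sigma)=(b_1,\dots,b_n)$ with $b_i=\sigma^{-k_i}(i)$, $k_i\ge1$ smallest with $\sigma^{-k_i}(i)\le i$, and $\mathsf{Lmic}_1(\sigma)=\{i:b_i=1\}$. *)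

(* Defs.v *)
From mathcomp Require Import all_boot all_fingroup.

Set Implicit Arguments.
Unset Strict Implicit.
Unset Printing Implicit Defensive.

(* Indices and letters are 0-based: i : 'I_n stands for the element i.+1
   of [n] = {1, ..., n}.  In particular the letter 1 is the ordinal of value 0,
   and i |-> n + 1 - i on [n] is rev_ord. *)

Definition set_stat (n : nat) : Type := 'S_n -> {set 'I_n}.

Definition Lmip {n : nat} : set_stat n :=
  fun s => [set i : 'I_n | [forall (j : 'I_n | j < i), s i < s j]].

Definition Rmip {n : nat} : set_stat n :=
  fun s => [set i : 'I_n | [forall (j : 'I_n | i < j), s i < s j]].

Definition Lmap {n : nat} : set_stat n :=
  fun s => [set i : 'I_n | [forall (j : 'I_n | j < i), s j < s i]].

Definition Rmap {n : nat} : set_stat n :=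
  fun s => [set i : 'I_n | [forall (j : 'I_n | i < j), s j < s i]].

Definition Lmil {n : nat} : set_stat n := fun s => [set s i | i in Lmip s].
Definition Rmil {n : nat} : set_stat n := fun s => [set s i | i in Rmip s].
Definition Lmal {n : nat} : set_stat n := fun s => [set s i | i in Lmap s].
Definition Rmal {n : nat} : set_stat n := fun s => [set s i | i in Rmap s].

Definition Cyc {n : nat} : set_stat n :=
  fun s => [set i : 'I_n |
    [exists C in porbits s, (i \in C) && [forall j in C, i <= j]]].

Lemma bcode_exp_exists (n : nat) (s : 'S_n) (i : 'I_n) :
  exists k : nat, (0 < k) && ((s ^- k)%g i <= i).
Proof. by exists #[s]%g; rewrite order_gt0 expg_order invg1 perm1 leqnn. Qed.

Definition bcode_exp (n : nat) (s : 'S_n) (i : 'I_n) : nat :=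
  ex_minn (bcode_exp_exists s i).

Definition bcode (n : nat) (s : 'S_n) (i : 'I_n) : 'I_n :=
  (s ^- bcode_exp s i)%g i.

Definition Lmic1 {n : nat} : set_stat n :=
  fun s => [set i : 'I_n | val (bcode s i) == 0].

Definition star {n : nat} (T : set_stat n) : set_stat n :=
  fun s => [set rev_ord i | i in T s].

Definition equidist2 {n : nat} (t u : set_stat n * set_stat n) : Prop :=
  forall X Y : {set 'I_n},
    #|[set s : 'S_n | (t.1 s, t.2 s) == (X, Y)]|
    = #|[set s : 'S_n | (u.1 s, u.2 s) == (X, Y)]|.

Definition equidist3 {n : nat} (t u : set_stat n * set_stat n * set_stat n)
    : Prop :=
  forall X Y Z : {set 'I_n},
    #|[set s : 'S_n | (t.1.1 s, t.1.2 s, t.2 s) == (X, Y, Z)]|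
    = #|[set s : 'S_n | (u.1.1 s, u.1.2 s, u.2 s) == (X, Y, Z)]|.

(* Main.v *)
Require Import Defs.
From Stdlib Require List.
From mathcomp Require Import all_boot all_fingroup zify.

Set Implicit Arguments.
Unset Strict Implicit.
Unset Printing Implicit Defensive.

(* A permutation of size n + 1 is encoded by a letter b and a permutation of size
   n in two ways: insert the letter n + 1 at position b of the word, or insert
   n + 1 after b in its cycle.  In both cases the word carries n + 1 at position
   b and is unchanged (up to order) before it, so Lmap loses the positions >= b
   and gains b.  Likewise Rmil under word insertion and Cyc under cycle insertion
   gain n + 1 exactly when b = n + 1, and Lmil, resp. Lmic1, gain n + 1 exactly
   when b = 1.  Hence (Rmil, Lmil, Lmap) and (Cyc, Lmic1, Lmap) obey the same
   recursion.  The remaining triples come from the first one by the eight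
   symmetries of the square, and the partial triples follow because Cyc is
   invariant under inversion. *)

Local Open Scope group_scope.

(** * Reversal, complement and inversion acting on the statistics *)

Section Symmetries.

Variable n : nat.
Implicit Types s : 'S_n.

(** The longest permutation. Products act left factor first, so [s * rev_perm] complements the
    letters of [s] and [rev_perm * s] reverses its word. *)
Definition rev_perm : 'S_n := perm (@rev_ord_inj n).

Lemma rev_permE i : rev_perm i = rev_ord i.
Proof. by rewrite permE. Qed.

Lemma rev_permV : rev_perm^-1 = rev_perm.
Proof.
apply/permP => i; apply: (@perm_inj _ rev_perm).
by rewrite permKV !rev_permE rev_ordK.
Qed.

Lemma ltn_rev_ord (i j : 'I_n) : (rev_ord i < rev_ord j) = (j < i).
Proof. by rewrite /=; have := ltn_ord i; have := ltn_ord j; lia. Qed.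

Lemma Lmap_complement s : Lmap (s * rev_perm) = Lmip s.
Proof.
apply/setP => i; rewrite !inE; apply: eq_forallb => j.
by rewrite !permM !rev_permE ltn_rev_ord.
Qed.

Lemma Lmip_complement s : Lmip (s * rev_perm) = Lmap s.
Proof.
apply/setP => i; rewrite !inE; apply: eq_forallb => j.
by rewrite !permM !rev_permE ltn_rev_ord.
Qed.

Lemma mem_rev_ord (A : {set 'I_n}) i :
  (i \in [set rev_ord j | j in A]) = (rev_ord i \in A).
Proof. by rewrite -{1}(rev_ordK i) mem_imset //; apply: rev_ord_inj. Qed.

Lemma star_Rmap s : star Rmap s = Lmap (rev_perm * s).
Proof.
apply/setP => i; rewrite mem_rev_ord !inE.
apply/forall_inP/forall_inP => H j ltji.
  by rewrite !permM !rev_permE; apply: H; rewrite ltn_rev_ord.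
have := H (rev_ord j); rewrite !permM !rev_permE rev_ordK; apply.
by rewrite -ltn_rev_ord rev_ordK.
Qed.

Lemma star_Rmip s : star Rmip s = Lmip (rev_perm * s).
Proof.
apply/setP => i; rewrite mem_rev_ord !inE.
apply/forall_inP/forall_inP => H j ltji.
  by rewrite !permM !rev_permE; apply: H; rewrite ltn_rev_ord.
have := H (rev_ord j); rewrite !permM !rev_permE rev_ordK; apply.
by rewrite -ltn_rev_ord rev_ordK.
Qed.

Lemma mem_perm_imset s (A : {set 'I_n}) v :
  (v \in [set s i | i in A]) = (s^-1 v \in A).
Proof. by rewrite -{1}(permKV s v) mem_imset //; apply: perm_inj. Qed.

(** Inversion exchanges positions and letters: that no letter to the right of [v] is smaller means
    that no smaller letter has a larger position. *)
Lemma Rmil_inv s : Rmil s = Lmap s^-1.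
Proof.
apply/setP => v; rewrite mem_perm_imset !inE.
apply/forall_inP/forall_inP => H w.
  rewrite ltn_neqAle => /andP[nwv lewv]; rewrite ltnNge leq_eqVlt.
  apply/negP => /orP[/eqP/val_inj/perm_inj eqvw|/H].
    by rewrite eqvw eqxx in nwv.
  by rewrite !permKV ltnNge lewv.
move=> ltw; rewrite permKV ltnNge leq_eqVlt.
apply/negP => /orP[/eqP/val_inj eqvw|/H].
  by rewrite -eqvw permK ltnn in ltw.
by rewrite permK ltnNge (ltnW ltw).
Qed.

Lemma Lmil_inv s : Lmil s = Lmip s^-1.
Proof.
apply/setP => v; rewrite mem_perm_imset !inE.
apply/forall_inP/forall_inP => H w ltw.
  rewrite ltnNge leq_eqVlt; apply/negP => /orP[/eqP/val_inj/perm_inj eqvw|/H].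
    by rewrite eqvw ltnn in ltw.
  by rewrite !permKV ltnNge (ltnW ltw).
rewrite permKV ltnNge leq_eqVlt; apply/negP => /orP[/eqP/val_inj eqvw|/H].
  by rewrite -eqvw permK ltnn in ltw.
by rewrite permK ltnNge (ltnW ltw).
Qed.

Lemma Lmal_inv s : Lmal s = Rmip s^-1.
Proof.
apply/setP => v; rewrite mem_perm_imset -[X in Lmap X]invgK -Rmil_inv.
by rewrite mem_perm_imset invgK permKV.
Qed.

Lemma Rmal_inv s : Rmal s = Rmap s^-1.
Proof.
apply/setP => v; rewrite mem_perm_imset !inE.
apply/forall_inP/forall_inP => H w ltw.
  rewrite ltnNge leq_eqVlt; apply/negP => /orP[/eqP/val_inj/perm_inj eqvw|/H].
    by rewrite eqvw ltnn in ltw.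
  by rewrite !permKV ltnNge (ltnW ltw).
rewrite permKV ltnNge leq_eqVlt; apply/negP => /orP[/eqP/val_inj eqvw|/H].
  by rewrite eqvw permK ltnn in ltw.
by rewrite permK ltnNge (ltnW ltw).
Qed.

Lemma star_Lmal s : star Lmal s = Lmip (rev_perm * s^-1).
Proof. by rewrite -star_Rmip /star Lmal_inv. Qed.

Lemma star_Rmal s : star Rmal s = Lmap (rev_perm * s^-1).
Proof. by rewrite -star_Rmap /star Rmal_inv. Qed.

End Symmetries.

(** * Inserting a largest element into a word or into a cycle *)

Section Insertion.

Variable n : nat.
Implicit Types (s r : 'S_n) (a b : 'I_n.+1) (k : 'I_n).

Definition extend_set (X : {set 'I_n}) (c : bool) : {set 'I_n.+1} :=
  [set i | if unlift ord_max i is Some k then k \in X else c].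

(** The effect on [Lmap] of placing the largest letter at position [b]. *)
Definition truncate_set (X : {set 'I_n}) b : {set 'I_n.+1} :=
  [set i | (i == b) || (i < b) && (i \in extend_set X false)].

Lemma extend_setP (X : {set 'I_n}) c (Y : {set 'I_n.+1}) :
    (forall k, (lift ord_max k \in Y) = (k \in X)) -> (ord_max \in Y) = c ->
  Y = extend_set X c.
Proof.
move=> HX Hc; apply/setP => i; rewrite inE.
by case: unliftP => [k ->|->].
Qed.

Lemma lift_lt_max k : (lift ord_max k : 'I_n.+1) < n.
Proof. by rewrite lift_max. Qed.

Lemma lt_lift_max k (i : 'I_n.+1) : i < k -> exists j, i = lift ord_max j.
Proof.
move=> ltik; case: (unliftP ord_max i) => [j ->|eqi]; first by exists j.
by move: ltik; rewrite eqi /= ltnNge ltnW.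
Qed.

Lemma ltn_lift (a : 'I_n.+1) (j k : 'I_n) :
  (lift a j < lift a k) = (j < k).
Proof. by rewrite !ltnNge /= leq_bump2. Qed.

Lemma forall_lt_lift_max k (P : pred 'I_n.+1) :
  [forall (j : 'I_n.+1 | j < lift ord_max k), P j] =
  [forall (j : 'I_n | j < k), P (lift ord_max j)].
Proof.
apply/forall_inP/forall_inP => H j; first by rewrite -(ltn_lift ord_max) => /H.
rewrite lift_max => ltjk; have [i eqj] := lt_lift_max ltjk.
by rewrite eqj; apply: H; rewrite -(lift_max i) -eqj.
Qed.

Lemma forall_lt_max (P : pred 'I_n.+1) :
  [forall (j : 'I_n.+1 | j < @ord_max n), P j] = [forall j, P (lift ord_max j)].
Proof.
apply/forall_inP/forallP => H j; first exact/H/lift_lt_max.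
by case: (unliftP ord_max j) => [k ->|->] //=; rewrite ltnn.
Qed.

(** [lift_perm ord_max a s] appends the letter [a] to the word and raises the letters at or above
    it, so earlier comparisons persist and only the last position needs a test. *)
Lemma Lmap_lift_perm a s :
  Lmap (lift_perm ord_max a s) = extend_set (Lmap s) (a == ord_max).
Proof.
apply: extend_setP => [k|]; rewrite !inE.
  rewrite forall_lt_lift_max; apply: eq_forallb => j.
  by rewrite !lift_perm_lift ltn_lift.
rewrite forall_lt_max; apply/forallP/eqP => [H|-> j].
  case: (unliftP ord_max a) => [k eqa|//].
  (* The letter [k] has the value of [a], so [lift a] raises it to [a + 1], above the last
     letter. *)
  have := H (s^-1 k); rewrite lift_perm_lift lift_perm_id permKV /= /bump eqa.
  by rewrite lift_max; lia.
by rewrite lift_perm_lift lift_perm_id lift_lt_max.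
Qed.

Lemma Lmip_lift_perm a s :
  Lmip (lift_perm ord_max a s) = extend_set (Lmip s) (val a == 0).
Proof.
apply: extend_setP => [k|]; rewrite !inE.
  rewrite forall_lt_lift_max; apply: eq_forallb => j.
  by rewrite !lift_perm_lift ltn_lift.
rewrite forall_lt_max; apply/forallP/eqP => [H|a0 j].
  case: (posnP a) => // a_gt0; have lta := ltn_ord a.
  (* For [a > 0] the letter 0 of [s] is not raised and stays below the last letter. *)
  have k0 : 0 < n by lia.
  have := H (s^-1 (Ordinal k0)).
  by rewrite lift_perm_lift lift_perm_id permKV /= /bump; lia.
by rewrite lift_perm_lift lift_perm_id /= /bump; move: a0 => /= ->.
Qed.

(* The hypotheses say nothing about q beyond position b: once the maximal letter
   sits there, no later position can carry a left-to-right maximum. *)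
Lemma Lmap_max_at (q : 'S_n.+1) r b :
    q b = ord_max ->
    (forall k, k < b -> q (lift ord_max k) = lift ord_max (r k)) ->
  Lmap q = truncate_set (Lmap r) b.
Proof.
move=> qb qr; apply/setP => i; rewrite !inE.
case: (ltngtP i b) => [ltib|ltbi|/val_inj eqib].
- have -> : i == b = false by apply/eqP => eqi; rewrite eqi ltnn in ltib.
  case: unliftP => [k eqi|eqi]; last first.
    by move: ltib; rewrite eqi ltnNge -ltnS ltn_ord.
  subst i; rewrite lift_max in ltib.
  rewrite forall_lt_lift_max /= inE; apply: eq_forallb_in => j ltjk.
  by rewrite !qr ?ltn_lift // (ltn_trans ltjk).
- have -> : i == b = false by apply/eqP => eqi; rewrite eqi ltnn in ltbi.
  by apply/forall_inP => /(_ b ltbi); rewrite qb ltnNge -ltnS ltn_ord.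
- rewrite eqib eqxx /=; apply/forall_inP => j ltjb.
  rewrite qb ltn_neqAle -[_ <= _]ltnS ltn_ord andbT.
  apply/eqP => eqm; have /perm_inj eqjb : q j = q b by rewrite qb; apply: val_inj.
  by rewrite eqjb ltnn in ltjb.
Qed.

Lemma lift_perm_inj (i j : 'I_n.+1) : injective (@lift_perm n i j).
Proof.
move=> s r eqsr; apply/permP => k; apply: (@lift_inj _ j).
by rewrite -!(lift_perm_lift i) eqsr.
Qed.

Definition insert_word (p : 'I_n.+1 * 'S_n) : 'S_n.+1 :=
  lift_perm p.1 ord_max p.2.

Lemma insert_word_inj : injective insert_word.
Proof.
move=> [a s] [b r]; rewrite /insert_word /= => eqp.
have eqab : a = b.
  by apply: (@perm_inj _ (lift_perm a ord_max s)); rewrite {2}eqp !lift_perm_id.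
by rewrite eqab in eqp *; rewrite (lift_perm_inj eqp).
Qed.

(** In the inverse, inserting the largest letter at position [a] becomes appending the letter
    [a]. *)
Lemma Rmil_insert_word a s :
  Rmil (insert_word (a, s)) = extend_set (Rmil s) (a == ord_max).
Proof. by rewrite !Rmil_inv lift_permV Lmap_lift_perm. Qed.

Lemma Lmil_insert_word a s :
  Lmil (insert_word (a, s)) = extend_set (Lmil s) (val a == 0).
Proof. by rewrite !Lmil_inv lift_permV Lmip_lift_perm. Qed.

Lemma Lmap_insert_word a s :
  Lmap (insert_word (a, s)) = truncate_set (Lmap s) a.
Proof.
apply: Lmap_max_at => [|k ltka]; first exact: lift_perm_id.
rewrite -(lift_perm_lift a ord_max s); congr (lift_perm _ _ _ _).
(* Since [k < a], both lifts keep the value of [k]. *)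
by apply: val_inj; rewrite [LHS]lift_max /= /bump leqNgt ltka.
Qed.

(* Inserts the new largest element after b in its cycle (as a fixed point when b
   is that element). *)
Definition insert_cycle (p : 'I_n.+1 * 'S_n) : 'S_n.+1 :=
  tperm p.1 ord_max * lift_perm ord_max ord_max p.2.

Lemma insert_cycle_id b s : insert_cycle (b, s) b = ord_max.
Proof. by rewrite permM tpermL lift_perm_id. Qed.

Lemma insert_cycle_inj : injective insert_cycle.
Proof.
move=> [a s] [b r] eqp.
have eqab : a = b.
  apply: (@perm_inj _ (insert_cycle (a, s))).
  by rewrite {2}eqp !insert_cycle_id.
by move: eqp; rewrite eqab => /mulgI/lift_perm_inj /= ->.
Qed.

Lemma Lmap_insert_cycle b s :
  Lmap (insert_cycle (b, s)) = truncate_set (Lmap s) b.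
Proof.
apply: Lmap_max_at => [|k ltkb]; first exact: insert_cycle_id.
rewrite permM tpermD ?lift_perm_lift ?neq_lift //.
by apply/eqP => /= eqb; rewrite eqb lift_max ltnn in ltkb.
Qed.

End Insertion.

(** * The B-code as a first return along backward orbits *)

Section FirstReturn.

Variable n : nat.
Implicit Types (t : 'S_n) (x y : 'I_n) (m : nat).

(* [first_return t m x y]: y is the first point at most m met on the orbit
   t x, t (t x), ... *)
Inductive first_return t m : 'I_n -> 'I_n -> Prop :=
| FirstReturn0 x : t x <= m -> first_return t m x (t x)
| FirstReturnS x y : m < t x -> first_return t m (t x) y -> first_return t m x y.

Lemma first_return_uniq t m x y z :
  first_return t m x y -> first_return t m x z -> y = z.
Proof.
move=> Hy; elim: Hy z => {x y} [x letx|x y lttx _ IH] z Hz.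
  by case: {x z} Hz letx => // x z ltm _ lem; rewrite ltnNge lem in ltm.
by case: {x z} Hz lttx IH => [x letx|x z _ H _ IH]; [rewrite ltnNge letx|apply: IH].
Qed.

Lemma first_return_iter t m k x :
    iter k.+1 t x <= m -> (forall j, j < k -> m < iter j.+1 t x) ->
  first_return t m x (iter k.+1 t x).
Proof.
elim: k x => [|k IH] x lem ltm; first exact: FirstReturn0.
apply: FirstReturnS; first exact: (ltm 0).
rewrite iterSr; apply: IH => [|j ltjk]; first by rewrite -iterSr.
by rewrite -iterSr; apply: ltm.
Qed.

(** Minimality of the exponent forces all intermediate points of the backward orbit above [x]. *)
Lemma first_return_bcode t x : first_return t^-1 x x (bcode t x).
Proof.
rewrite /bcode /bcode_exp; case: ex_minnP => k /andP[k_gt0 lek] mink.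
case: k k_gt0 lek mink => // k _ lek mink.
rewrite -expgVn permX; apply: first_return_iter => [|j ltjk].
  by rewrite -permX expgVn.
rewrite ltnNge -permX expgVn; apply/negP => lej.
by have := mink j.+1 lej; rewrite ltnS leqNgt ltjk.
Qed.

Lemma mem_Cyc t x : (x \in Cyc t) = [forall y in porbit t x, x <= y].
Proof.
rewrite inE; apply/exists_inP/idP => [[_ /imsetP[z _ ->] /andP[xz H]]|H].
  by rewrite -eq_porbit_mem in xz; rewrite -(eqP xz) in H *.
by exists (porbit t x); rewrite ?H ?porbit_id // imset_f.
Qed.

Lemma Cyc_inv t : Cyc t^-1 = Cyc t.
Proof. by apply/setP => x; rewrite !mem_Cyc porbitV. Qed.

(** If the first return is [x] itself, the walk has gone once round the cycle and met only larger
    points. *)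
Lemma mem_Cyc_bcode t x : (x \in Cyc t) = (bcode t x == x).
Proof.
rewrite mem_Cyc -porbitV /bcode /bcode_exp.
case: ex_minnP => k /andP[k_gt0 lek] mink.
apply/forall_inP/eqP => [H|fixk].
  apply/val_inj/eqP; rewrite eqn_leq lek H //.
  by apply/porbitP; exists k; rewrite expgVn.
(* Exponents below [k] are settled by minimality; larger ones drop by the period [k]. *)
move=> _ /porbitP[m ->]; elim/ltn_ind: m => m IH.
case: (posnP m) => [->|m_gt0]; first by rewrite perm1.
case: (ltnP m k) => [ltmk|lekm].
  rewrite leqNgt expgVn; apply/negP => /ltnW lem.
  by have := mink m; rewrite m_gt0 lem leqNgt ltmk => /(_ isT).
rewrite -(subnKC lekm) expgD permM [_ ^+ k]expgVn fixk; apply: IH.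
by rewrite ltn_subrL k_gt0.
Qed.

End FirstReturn.

(** * The B-code records the choices made in cycle insertion *)

Section InsertCycle.

Variable n : nat.
Implicit Types (s : 'S_n) (b : 'I_n.+1).

(** The inserted element exceeds the bound [m], so passing through it never ends the walk. *)
Lemma first_return_insert_cycle b s (m : 'I_n) x y :
    first_return s^-1 m x y ->
  first_return (insert_cycle (b, s))^-1 m (lift ord_max x) (lift ord_max y).
Proof.
have Ex z : (insert_cycle (b, s))^-1 (lift ord_max z)
    = tperm b ord_max (lift ord_max (s^-1 z)).
  by rewrite invMg permM lift_permV lift_perm_lift tpermV.
have Emax : (insert_cycle (b, s))^-1 ord_max = b.
  by rewrite invMg permM lift_permV lift_perm_id tpermV tpermR.
(* The orbit of lift z follows that of z, with one detour through ord_max. *)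
have step z : (insert_cycle (b, s))^-1 (lift ord_max z) = lift ord_max (s^-1 z)
    \/ (insert_cycle (b, s))^-1 (lift ord_max z) = ord_max
       /\ (insert_cycle (b, s))^-1 ord_max = lift ord_max (s^-1 z).
  rewrite Ex Emax; case: tpermP => [<-|/eqP|]; [by right| |by left].
  by rewrite eq_sym (negPf (neq_lift _ _)).
elim=> {x y} [x lex|x y ltx _ IH]; case: (step x) => [E|[E1 E2]].
- by rewrite -E; apply: FirstReturn0; rewrite E lift_max.
- apply: FirstReturnS; rewrite E1 ?ltn_ord // -E2.
  by apply: FirstReturn0; rewrite E2 lift_max.
- by apply: FirstReturnS; rewrite E // lift_max.
- apply: FirstReturnS; rewrite E1 ?ltn_ord //.
  by apply: FirstReturnS; rewrite E2 // lift_max.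
Qed.

Lemma bcode_insert_cycle_lift b s k :
  bcode (insert_cycle (b, s)) (lift ord_max k) = lift ord_max (bcode s k).
Proof.
have := first_return_bcode (insert_cycle (b, s)) (lift ord_max k).
rewrite {1}lift_max => H.
exact/(first_return_uniq H)/first_return_insert_cycle/first_return_bcode.
Qed.

(** Every point is at most [ord_max], so the walk stops after one step, at the preimage [b]. *)
Lemma bcode_insert_cycle_max b s : bcode (insert_cycle (b, s)) ord_max = b.
Proof.
apply: (first_return_uniq (first_return_bcode _ _)).
rewrite -[X in first_return _ _ _ X](permK (insert_cycle (b, s)) b).
rewrite insert_cycle_id; apply: FirstReturn0.
by rewrite -ltnS ltn_ord.
Qed.

Lemma Cyc_insert_cycle b s :
  Cyc (insert_cycle (b, s)) = extend_set (Cyc s) (b == ord_max).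
Proof.
apply: extend_setP => [k|]; rewrite !mem_Cyc_bcode ?bcode_insert_cycle_max //.
by rewrite bcode_insert_cycle_lift (inj_eq lift_inj).
Qed.

Lemma Lmic1_insert_cycle b s :
  Lmic1 (insert_cycle (b, s)) = extend_set (Lmic1 s) (val b == 0).
Proof.
apply: extend_setP => [k|]; rewrite !inE ?bcode_insert_cycle_max //.
by rewrite bcode_insert_cycle_lift [val _]lift_max.
Qed.

End InsertCycle.

(** Recursively, undo a cycle insertion, transfer the smaller permutation, and redo the same choice
    [b] as a word insertion. *)
Lemma cycle_word_transfer n : exists2 f : 'S_n -> 'S_n, injective f
  & forall s, [/\ Cyc s = Rmil (f s), Lmic1 s = Lmil (f s) & Lmap s = Lmap (f s)].
Proof.
elim: n => [|n [f injf statf]].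
  by exists id => // s; split; apply/setP => -[].
(* Equal cardinalities turn the injective cycle insertion into a bijection with inverse [g]. *)
have card_le : #|'S_n.+1| <= #|{: 'I_n.+1 * 'S_n}|.
  by rewrite card_prod card_ord !card_Sn.
have [g cancgi cancig] := inj_card_bij (@insert_cycle_inj n) card_le.
exists (fun s => insert_word ((g s).1, f (g s).2)) => [s r|s].
  move/insert_word_inj => [eq1 /injf eq2]; apply: (can_inj cancig).
  by rewrite [g s]surjective_pairing eq1 eq2 -surjective_pairing.
(* Only the arguments of the left-hand statistics are rewritten as cycle insertions. *)
rewrite -{1 4 7}(cancig s); case: (g s) => b r /=.
have [Cr Lr Mr] := statf r; split.
- by rewrite Cyc_insert_cycle Rmil_insert_word Cr.
- by rewrite Lmic1_insert_cycle Lmil_insert_word Lr.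
- by rewrite Lmap_insert_cycle Lmap_insert_word Mr.
Qed.

Section Equidistribution.

Variable n : nat.
Implicit Types f : 'S_n -> 'S_n.

(** An injection of a finite set into itself is a bijection, so it maps each fibre of [F] onto that
    of [G]. *)
Lemma card_pullback (T : eqType) (F G : 'S_n -> T) f (z : T) :
    injective f -> (forall s, F s = G (f s)) ->
  #|[set s | F s == z]| = #|[set s | G s == z]|.
Proof.
move=> injf FG; rewrite -(card_imset _ injf); apply: eq_card => s.
have [g fK gK] := injF_bij injf.
by rewrite -{1}(gK s) mem_imset // !inE FG gK.
Qed.

Lemma equidist3_pullback (t u : set_stat n * set_stat n * set_stat n) f :
    injective f ->
    (forall s, (t.1.1 s, t.1.2 s, t.2 s) = (u.1.1 (f s), u.1.2 (f s), u.2 (f s))) ->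
  equidist3 t u.
Proof. by move=> injf H X Y Z; apply: card_pullback injf _. Qed.

Lemma equidist2_pullback (t u : set_stat n * set_stat n) f :
    injective f ->
    (forall s, (t.1 s, t.2 s) = (u.1 (f s), u.2 (f s))) ->
  equidist2 t u.
Proof. by move=> injf H X Y; apply: card_pullback injf _. Qed.

End Equidistribution.

Theorem theorem4p2 (n : nat) :
  (forall t u : set_stat n * set_stat n * set_stat n,
     let triples : seq (set_stat n * set_stat n * set_stat n) :=
       [:: (Rmil, Lmil, Lmap);
           (Cyc, Lmic1, Lmap);
           (Lmap, Lmip, Rmil);
           (star Rmip, star Rmap, star Lmal);
           (star Lmal, star Rmal, star Rmip);
           (Lmil, Rmil, star Rmap);
           (star Rmal, star Lmal, Lmip);
           (star Rmap, star Rmip, Lmil);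
           (Lmip, Lmap, star Rmal)] in
     List.In t triples -> List.In u triples -> equidist3 t u)
  /\ equidist2 (n := n) (Lmap, Cyc) (Rmil, Lmap)
  /\ equidist2 (n := n) (Lmic1, Cyc) (Rmil, Lmil)
  /\ equidist2 (n := n) (Cyc, Rmil) (Rmil, Lmap)
  /\ equidist2 (n := n) (Rmil, Cyc) (Rmil, Lmap).
Proof.
have [f injf statf] := cycle_word_transfer n.
pose r := rev_perm n.
split=> [t u triples|].
  suff to_base v : List.In v triples -> equidist3 v (Rmil, Lmil, Lmap).
    by move=> /to_base Ht /to_base Hu X Y Z; rewrite Ht Hu.
  have Vr : r^-1 = r := rev_permV n.
  have injV : injective (fun s : 'S_n => s^-1) := invg_inj.
  have injR : injective (fun s : 'S_n => r * s) := mulgI r.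
  have injC : injective (fun s : 'S_n => s * r) := mulIg r.
  (* From the third triple on, the maps are the seven nontrivial symmetries of the square, composed
     from [injV], [injR] and [injC]. *)
  rewrite /triples /=; repeat case=> [<-|].
  - by move=> X Y Z.
  - by apply: (equidist3_pullback injf) => s /=; have [-> -> ->] := statf s.
  - apply: (equidist3_pullback injV) => s /=.
    by rewrite !Rmil_inv Lmil_inv invgK.
  - apply: (equidist3_pullback (inj_comp injV (inj_comp injC injR))) => s /=.
    rewrite !Rmil_inv Lmil_inv invgK star_Rmip star_Rmap star_Lmal.
    by rewrite Lmap_complement Lmip_complement !invMg Vr mulgA Lmap_complement.
  - apply: (equidist3_pullback (inj_comp injC injR)) => s /=.
    rewrite !Rmil_inv Lmil_inv !invMg Vr mulgA star_Rmip star_Rmal star_Lmal.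
    by rewrite !Lmap_complement Lmip_complement.
  - apply: (equidist3_pullback injR) => s /=.
    rewrite !Rmil_inv !Lmil_inv invMg Vr star_Rmap.
    by rewrite !Lmap_complement Lmip_complement.
  - apply: (equidist3_pullback injC) => s /=.
    rewrite !Rmil_inv !Lmil_inv invMg Vr star_Rmal star_Lmal.
    by rewrite !Lmap_complement.
  - apply: (equidist3_pullback (inj_comp injC injV)) => s /=.
    rewrite !Rmil_inv !Lmil_inv invMg Vr invgK star_Rmap star_Rmip.
    by rewrite !Lmap_complement.
  - apply: (equidist3_pullback (inj_comp injR injV)) => s /=.
    rewrite !Rmil_inv !Lmil_inv invMg Vr invgK star_Rmal.
    by rewrite !Lmap_complement Lmip_complement.
split; [|split; [|split]].
(* Inversion after [f] swaps [Rmil] and [Lmap]. *)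
- apply: (equidist2_pullback (inj_comp (@invg_inj _) injf)) => s /=.
  by have [-> _ ->] := statf s; rewrite !Rmil_inv invgK.
(* Reversal after [f] swaps [Rmil] and [Lmil]. *)
- apply: (equidist2_pullback (inj_comp (mulgI r) injf)) => s /=.
  have [-> -> _] := statf s.
  by rewrite !Rmil_inv !Lmil_inv invMg rev_permV Lmap_complement Lmip_complement.
(* Inversion before [f] keeps [Cyc] and turns [Rmil] into [Lmap]. *)
- apply: (equidist2_pullback (inj_comp injf (@invg_inj _))) => s /=.
  by have [<- _ <-] := statf s^-1; rewrite Cyc_inv Rmil_inv.
(* Conjugating [f] by inversion combines both effects. *)
- apply: (equidist2_pullback
    (inj_comp (@invg_inj _) (inj_comp injf (@invg_inj _)))) => s /=.
  have [Cs _ Ms] := statf s^-1.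
  by rewrite -Cyc_inv Cs !Rmil_inv invgK Ms.
Qed.
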